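(* Let $\mathcal{B}=\{B_1,\dots,B_q\}$ be a partition of a set of $n\ge 2$ nodes into $q$ blocks and let $\bm{P}=(p_{rs})$ be a symmetric $q\times q$ matrix with entries in $[0,1]$. Let $\mathbb{P}(\cdot|\mathcal{B},\bm{P})$ be the stochastic block model distribution on simple graphs on these nodes, let $\rho$ be its average density, and let $\mathbb{Q}(\cdot|\rho)$ be the Erdős–Rényi distribution of density $\rho$ on the same nodes. Then the average of the normalized log-likelihood ratio over the stochastic block model, $$\langle\mathcal{L}\rangle=\frac{1}{m^{\max}}\sum_{G}\mathbb{P}(G|\mathcal{B},\bm{P})\log\frac{\mathbb{P}(G|\mathcal{B},\bm{P})}{\mathbb{Q}(G|\rho)},$$ where the sum runs over all simple graphs $G$ on the $n$ labeled nodes, satisfies $$\langle\mathcal{L}\rangle=h(\rho)-\sum_{1\le r\le s\le q}\alpha_{rs}\,h(p_{rs}).$$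
   Context: Write $n_r=|B_r|$. In the stochastic block model with parameters $(\mathcal{B},\bm{P})$, each unordered pair of distinct nodes, one in $B_r$ and the other in $B_s$, is joined by an edge independently with probability $p_{rs}$ (no self-loops, undirected). Set $m_{rr}^{\max}=\binom{n_r}{2}$, $m_{rs}^{\max}=n_rn_s$ for $r<s$, $m^{\max}=\sum_{r\le s}m_{rs}^{\max}=\binom n2$, $\alpha_{rs}=m_{rs}^{\max}/m^{\max}$, and the average density $\rho=\sum_{r\le s}\alpha_{rs}p_{rs}$. The Erdős–Rényi distribution $\mathbb{Q}(\cdot|\rho)$ joins each unordered pair of distinct nodes independently with probability $\rho$. The binary entropy is $h(p)=-p\log p-(1-p)\log(1-p)$. Conventions: $0\log 0=0$, and terms of the sum over $G$ with $\mathbb{P}(G|\mathcal{B},\bm{P})=0$ are $0$. *)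

(* Defs.v *)
From mathcomp Require Import all_boot all_order all_algebra.
From mathcomp Require Import reals exp.

Set Implicit Arguments.
Unset Strict Implicit.
Unset Printing Implicit Defensive.

Import Order.TTheory GRing.Theory Num.Theory.

Local Open Scope ring_scope.

Section Graphs.
Variable T : finType.

(* The unordered pairs of distinct nodes, one in A and the other in B. Since
   these are sets of nodes, each pair occurs once, also when A = B. *)
Definition pairs_between (A B : {set T}) : {set {set T}} :=
  [set [set x; y] | x in A, y in B & x != y].

Definition node_pairs : {set {set T}} := pairs_between setT setT.

(* A simple graph on T is identified with its edge set. *)
Definition simple_graphs : {set {set {set T}}} := powerset node_pairs.

Definition indep_edges_prob (R : realType) (w : {set T} -> R)
    (G : {set {set T}}) : R :=
  \prod_(e in node_pairs) (if e \in G then w e else 1 - w e).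

Definition er_prob (R : realType) (rho : R) : {set {set T}} -> R :=
  indep_edges_prob (fun=> rho).

End Graphs.

Section BlockModel.
Variables (R : realType) (T : finType) (q : nat).

Definition block_partition (B : 'I_q -> {set T}) : Prop :=
  injective B /\ partition [set B r | r : 'I_q] [set: T].

Variables (B : 'I_q -> {set T}) (P : 'M[R]_q).

(* If B is a partition, then for e a pair of distinct nodes the picked (r, s)
   is unique up to exchanging r and s, so that the value is well defined as
   soon as P is symmetric. The default value 0 is then never used on
   node_pairs T. *)
Definition sbm_edge_prob (e : {set T}) : R :=
  if [pick rs : 'I_q * 'I_q | e \in pairs_between (B rs.1) (B rs.2)] is Some rs
  then P rs.1 rs.2 else 0.

Definition sbm_prob : {set {set T}} -> R := indep_edges_prob sbm_edge_prob.

Definition block_mmax (r s : 'I_q) : nat :=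
  if r == s then 'C(#|B r|, 2) else (#|B r| * #|B s|)%N.

Definition mmax : nat :=
  (\sum_(r < q) \sum_(s < q | r <= s) block_mmax r s)%N.

Definition block_frac (r s : 'I_q) : R := (block_mmax r s)%:R / mmax%:R.

Definition avg_density : R :=
  \sum_(r < q) \sum_(s < q | (r <= s)%N) block_frac r s * P r s.

End BlockModel.

(* ln is total, hence 0 * ln 0 = 0. *)
Definition binary_entropy (R : realType) (p : R) : R :=
  - p * ln p - (1 - p) * ln (1 - p).

(* Main.v *)
(** On graphs of nonzero probability the log-likelihood ratio is a sum over the
    node pairs, because both models draw edges independently; its mean is thus
    computed pair by pair. Since [rho] is the mean of the edge probabilities,
    the terms in [ln rho] and [ln (1 - rho)] collect into [h(rho)]; for the same
    reason [rho] is 0 (or 1) only if all edge probabilities are, which settles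
    the degenerate cases. *)

Require Import Defs.
From mathcomp Require Import all_boot all_order all_algebra.
From mathcomp Require Import reals exp.
From mathcomp Require Import ring.

Set Implicit Arguments.
Unset Strict Implicit.
Unset Printing Implicit Defensive.

Import Order.TTheory GRing.Theory Num.Theory.

Local Open Scope ring_scope.

(** Distributivity: each term of the expanded product picks [a i] or [b i] for every [i] in [D], and
    [J] records where [a i] was picked. *)
Lemma prodrD_powerset (R : comPzSemiRingType) (I : finType) (D : {set I})
    (a b : I -> R) :
  \prod_(i in D) (a i + b i) =
  \sum_(J in powerset D) \prod_(i in D) (if i \in J then a i else b i).
Proof.
(* Outside [D] the summands become 0 and 1: the factor stays 1, and every [J] not contained in [D]
   contributes a zero term. *)
transitivity (\prod_i ((if i \in D then a i else 0) +
                       (if i \in D then b i else 1))).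
  by rewrite big_mkcond; apply: eq_bigr => i _; case: ifP; rewrite ?add0r.
rewrite bigA_distr [RHS]big_mkcond; apply: eq_bigr => J _.
rewrite powersetE; case: ifPn => [sJD | /subsetPn[i iJ iD]].
  rewrite [RHS]big_mkcond; apply: eq_bigr => i _.
  case: (boolP (i \in D)) => // iD.
  by case: ifP => // iJ; rewrite (subsetP sJD) in iD.
by rewrite (bigD1 i) //= iJ (negPf iD) mul0r.
Qed.

(** * Expectations and relative entropy for independent edges *)

Section IndependentEdges.
Variables (R : realType) (T : finType) (w : {set T} -> R).

(** The weight depends on [G] only through [e], so it can be absorbed into the factor at [e]. The
    sum over graphs then factors, and each [f] other than [e] gives [w f + (1 - w f) = 1]. *)
Lemma indep_edges_mean_edge (u v : {set T} -> R) (e : {set T}) :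
  e \in node_pairs T ->
  \sum_(G in simple_graphs T)
    indep_edges_prob w G * (if e \in G then u e else v e) =
  w e * u e + (1 - w e) * v e.
Proof.
move=> eD.
pose a f := w f * (if f == e then u f else 1).
pose b f := (1 - w f) * (if f == e then v f else 1).
transitivity (\prod_(f in node_pairs T) (a f + b f)).
  rewrite prodrD_powerset; apply: eq_bigr => G _.
  rewrite /indep_edges_prob (bigD1 e) //= [RHS](bigD1 e) //= /a /b eqxx.
  rewrite mulrAC; congr (_ * _); first by case: ifP.
  by apply: eq_bigr => f /andP[_ /negPf->]; rewrite !mulr1.
rewrite (bigD1 e) //= big1 ?mulr1 /a /b ?eqxx // => f /andP[_ /negPf->].
by rewrite !mulr1 subrKC.
Qed.

Lemma indep_edges_mean (u v : {set T} -> R) :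
  \sum_(G in simple_graphs T) indep_edges_prob w G *
    (\sum_(e in node_pairs T) (if e \in G then u e else v e)) =
  \sum_(e in node_pairs T) (w e * u e + (1 - w e) * v e).
Proof.
under eq_bigr => G _ do rewrite mulr_sumr.
rewrite exchange_big /=; apply: eq_bigr => e; exact: indep_edges_mean_edge.
Qed.

Hypothesis w01 : forall e, e \in node_pairs T -> 0 <= w e <= 1.

(** The logarithm splits only over positive factors. A nonzero probability makes each factor of the
    numerator positive, and the two conditions on [rho] carry this over to the matching factor of
    the denominator. *)
Lemma ln_indep_edges_ratio (rho : R) (G : {set {set T}}) :
  (forall e, e \in node_pairs T -> 0 < w e -> 0 < rho) ->
  (forall e, e \in node_pairs T -> w e < 1 -> rho < 1) ->
  indep_edges_prob w G != 0 ->
  ln (indep_edges_prob w G / er_prob rho G) =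
  \sum_(e in node_pairs T)
    (if e \in G then ln (w e) - ln rho else ln (1 - w e) - ln (1 - rho)).
Proof.
move=> rho0 rho1 /prodf_neq0 wG.
rewrite /er_prob /indep_edges_prob -prodf_div.
pose x e : R := (if e \in G then w e else 1 - w e) /
                (if e \in G then rho else 1 - rho).
have xP e : e \in node_pairs T -> 0 < x e /\ ln (x e) =
    if e \in G then ln (w e) - ln rho else ln (1 - w e) - ln (1 - rho).
  move=> eD; move: (wG e eD) (w01 eD); rewrite /x.
  case: ifP => _ w_neq /andP[w_ge0 w_le1].
    have w_gt0 : 0 < w e by rewrite lt_def w_neq.
    have r_gt0 := rho0 e eD w_gt0.
    by rewrite divr_gt0 // ln_div.
  have w_gt0 : 0 < 1 - w e by rewrite lt_def w_neq subr_ge0.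
  have r_gt0 : 0 < 1 - rho by rewrite subr_gt0 (rho1 e) // -subr_gt0.
  by rewrite divr_gt0 // ln_div.
(* Positivity of the partial product is part of the induction, since [lnM] needs both arguments
   positive. *)
have [_ ->] : 0 < \prod_(e in node_pairs T) x e /\
    ln (\prod_(e in node_pairs T) x e) = \sum_(e in node_pairs T) ln (x e).
  elim/big_rec2: _ => [|e y z eD [z0 lnz]]; first by rewrite ln1.
  have [x0 _] := xP e eD.
  by rewrite lnM ?posrE // lnz mulr_gt0.
by apply: eq_bigr => e /xP[].
Qed.

Lemma indep_edges_kl (rho : R) :
  (forall e, e \in node_pairs T -> 0 < w e -> 0 < rho) ->
  (forall e, e \in node_pairs T -> w e < 1 -> rho < 1) ->
  \sum_(G in simple_graphs T)
     indep_edges_prob w G * ln (indep_edges_prob w G / er_prob rho G) =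
  - (\sum_(e in node_pairs T) w e) * ln rho
  - (\sum_(e in node_pairs T) (1 - w e)) * ln (1 - rho)
  - \sum_(e in node_pairs T) binary_entropy (w e).
Proof.
move=> rho0 rho1.
transitivity (\sum_(G in simple_graphs T) indep_edges_prob w G *
    \sum_(e in node_pairs T)
      (if e \in G then ln (w e) - ln rho else ln (1 - w e) - ln (1 - rho))).
  (* Graphs of probability zero vanish on both sides, whatever value [ln] takes there. *)
  apply: eq_bigr => G _; have [->|nz] := eqVneq (indep_edges_prob w G) 0.
    by rewrite !mul0r.
  by rewrite ln_indep_edges_ratio.
rewrite (indep_edges_mean (fun e => ln (w e) - ln rho)
                          (fun e => ln (1 - w e) - ln (1 - rho))).
rewrite mulNr !mulr_suml -!sumrN -!big_split /=.
by apply: eq_bigr => e _; rewrite /binary_entropy; ring.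
Qed.

End IndependentEdges.

(** * Membership and counting for unordered pairs *)

Section Pairs.
Variable T : finType.
Implicit Types (A B : {set T}) (x y : T).

Lemma pairs_betweenP A B (e : {set T}) :
  reflect (exists x y, [/\ x \in A, y \in B, x != y & e = [set x; y]])
          (e \in pairs_between A B).
Proof.
apply: (iffP imset2P) => [[x y xA] | [x [y [xA yB xy ->]]]].
  by rewrite inE => /andP[yB xy] ->; exists x, y.
by exists x y; rewrite ?inE ?yB.
Qed.

Lemma pairs_betweenS A B : pairs_between A B \subset node_pairs T.
Proof.
apply/subsetP => e /pairs_betweenP[x [y [_ _ xy ->]]].
by apply/pairs_betweenP; exists x, y.
Qed.

Lemma mem_set2_pairs_between A B x y : x != y ->
  ([set x; y] \in pairs_between A B) =
  ((x \in A) && (y \in B)) || ((y \in A) && (x \in B)).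
Proof.
move=> xy; apply/pairs_betweenP/orP => [[x' [y' [x'A y'B x'y' E]]]|].
  have := set21 x' y'; have := set22 x' y'; rewrite -E !inE.
  (* Of the four ways to match the endpoints, two contradict [x' != y']; the others are the given
     order and the swapped one. *)
  case/orP=> /eqP y'E /orP[]/eqP x'E; move: x'y' x'A y'B;
    rewrite x'E y'E ?eqxx // => _ -> ->; by [left | right].
case=> /andP[h1 h2]; first by exists x, y.
by exists y, x; rewrite setUC eq_sym.
Qed.

Lemma card_pairs_between_self A : #|pairs_between A A| = 'C(#|A|, 2).
Proof.
rewrite -cards_draws; apply: eq_card => e; rewrite !inE.
apply/pairs_betweenP/andP => [[x [y [xA yA xy ->]]] | [eA /cards2P[x [y [xy eE]]]]].
  by rewrite cards2 xy subUset !sub1set xA yA.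
by move: eA; rewrite eE subUset !sub1set => /andP[]; exists x, y.
Qed.

(** Disjointness tells which endpoint lies in [A], so sending [(x, y)] to [[set x; y]] is injective
    on [setX A B]. *)
Lemma card_pairs_between_disjoint A B : [disjoint A & B] ->
  #|pairs_between A B| = (#|A| * #|B|)%N.
Proof.
move=> dAB.
have neq x y : x \in A -> y \in B -> x != y.
  by move=> xA yB; apply: contraTneq yB => <-; rewrite (disjointFr dAB).
rewrite -cardsX.
have -> : pairs_between A B = [set [set p.1; p.2] | p in setX A B].
  apply/setP => e; apply/pairs_betweenP/imsetP.
    by case=> x [y [xA yB _ ->]]; exists (x, y); rewrite // inE xA.
  by case=> -[x y]; rewrite inE => /andP[xA yB] ->; exists x, y; split; auto.
apply: card_in_imset => -[x y] [x' y'] /setXP[/= xA yB] /setXP[/= x'A y'B] E.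
have := set21 x y; have := set22 x y; rewrite E !inE.
have xy' : x == y' = false by apply/negbTE/neq.
have yx' : y == x' = false by rewrite eq_sym; apply/negbTE/neq.
by rewrite xy' yx' orbF /= => /eqP-> /eqP->.
Qed.

End Pairs.

(** * From sums over blocks to sums over node pairs *)

Section BlockModel.
Variables (R : realType) (T : finType) (q : nat) (B : 'I_q -> {set T}).
Hypothesis hB : block_partition B.

(** The labelling [b] turns membership in a block into an equation between indices. Trivial
    intersections make the block of a node unique, and injectivity of [B] makes its index unique. *)
Lemma block_partition_index :
  exists b : T -> 'I_q, forall x r, (x \in B r) = (r == b x).
Proof.
case: hB => injB /and3P[/eqP covB trivB _].
have ex x : exists r, x \in B r.
  have : x \in cover [set B r | r : 'I_q] by rewrite covB inE.
  by case/bigcupP => _ /imsetP[r _ ->]; exists r.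
exists (fun x => xchoose (ex x)) => x r; apply/idP/eqP => [xr | ->]; last first.
  exact: (xchooseP (ex x)).
have xs := xchooseP (ex x); apply: injB.
by rewrite -(def_pblock trivB _ xr) ?imset_f // (def_pblock trivB _ xs) ?imset_f.
Qed.

Lemma card_pairs_between_blocks (r s : 'I_q) :
  #|pairs_between (B r) (B s)| = block_mmax B r s.
Proof.
rewrite /block_mmax; case: eqP => [-> | /eqP rs].
  exact: card_pairs_between_self.
apply: card_pairs_between_disjoint.
have [b bP] := block_partition_index.
rewrite -setI_eq0; apply/eqP/setP => x; rewrite !inE !bP.
by apply/andP => -[/eqP rE /eqP sE]; rewrite rE sE eqxx in rs.
Qed.

(** The picked indices are [(r, s)] or [(s, r)], and symmetry of [P] gives the same value for
    both. *)
Lemma sbm_edge_prob_block (P : 'M[R]_q) (r s : 'I_q) (e : {set T}) :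
  (forall r s : 'I_q, P r s = P s r) ->
  e \in pairs_between (B r) (B s) -> sbm_edge_prob B P e = P r s.
Proof.
move=> hPsym ers; have [b bP] := block_partition_index.
rewrite /sbm_edge_prob; case: pickP => [[r' s'] /= er's' | /(_ (r, s))]; last first.
  by rewrite /= ers.
have /pairs_betweenP[x [y [xr ys xy eE]]] := ers.
move: xr ys er's'; rewrite eE mem_set2_pairs_between // !bP.
by move=> /eqP-> /eqP-> /orP[]/andP[/eqP-> /eqP->].
Qed.

(** Each node pair lies in exactly one class with [r <= s], indexed by the labels of its endpoints
    in increasing order. *)
Lemma sum_node_pairs_blocks (F : {set T} -> R) :
  \sum_(e in node_pairs T) F e =
  \sum_(r < q) \sum_(s < q | (r <= s)%N)
    \sum_(e in pairs_between (B r) (B s)) F e.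
Proof.
have [b bP] := block_partition_index.
rewrite pair_big_dep /=.
transitivity (\sum_(rs : 'I_q * 'I_q | (rs.1 <= rs.2)%N)
    \sum_(e in node_pairs T)
      (if e \in pairs_between (B rs.1) (B rs.2) then F e else 0)); last first.
  apply: eq_bigr => rs _; rewrite -big_mkcondr /=; apply: eq_bigl => e.
  by rewrite andb_idl // => /(subsetP (pairs_betweenS _ _)).
rewrite exchange_big /=; apply: eq_bigr => e /pairs_betweenP[x0 [y0 [_ _ xy0 eE0]]].
have [x [y [xy eE le_b]]] : exists x y,
    [/\ x != y, e = [set x; y] & (b x <= b y)%N].
  have [le|/ltnW le] := leqP (b x0) (b y0); first by exists x0, y0.
  by exists y0, x0; rewrite eq_sym setUC.
rewrite (big_only1 (b x, b y)) //=.
  by rewrite eE mem_set2_pairs_between // !bP !eqxx.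
move=> [r s] /= rs_neq le_rs; rewrite eE mem_set2_pairs_between // !bP.
case: ifP => // /orP[]/andP[/eqP rE /eqP sE].
  by rewrite rE sE eqxx in rs_neq.
(* With the labels swapped, [r <= s] and [b x <= b y] force equal labels, so this is again the index
   [(b x, b y)]. *)
case/negP: rs_neq; move: le_rs; rewrite rE sE => le_rs; apply/eqP.
by congr (_, _); apply/val_inj/anti_leq; rewrite le_b le_rs.
Qed.

Lemma sum_sbm_edge_prob (P : 'M[R]_q) (f : R -> R) :
  (forall r s : 'I_q, P r s = P s r) ->
  \sum_(e in node_pairs T) f (sbm_edge_prob B P e) =
  \sum_(r < q) \sum_(s < q | (r <= s)%N) (block_mmax B r s)%:R * f (P r s).
Proof.
move=> hPsym; rewrite sum_node_pairs_blocks; apply: eq_bigr => r _.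
apply: eq_bigr => s _; rewrite -card_pairs_between_blocks mulr_natl.
rewrite -sumr_const; apply: eq_bigr => e ers.
by rewrite (sbm_edge_prob_block hPsym ers).
Qed.

(** Block averages become averages over node pairs; this serves with [f] the identity for the
    density and with [f] the binary entropy. *)
Lemma sum_block_frac (P : 'M[R]_q) (f : R -> R) :
  (forall r s : 'I_q, P r s = P s r) ->
  \sum_(r < q) \sum_(s < q | (r <= s)%N) block_frac R B r s * f (P r s) =
  (mmax B)%:R^-1 * \sum_(e in node_pairs T) f (sbm_edge_prob B P e).
Proof.
move=> hPsym; rewrite sum_sbm_edge_prob // mulr_sumr; apply: eq_bigr => r _.
by rewrite mulr_sumr; apply: eq_bigr => s _; rewrite mulrCA mulrA.
Qed.

(** This is the block decomposition of the constant sum 1, taken in [R] and read back in the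
    naturals. *)
Lemma card_node_pairs : #|node_pairs T| = mmax B.
Proof.
apply/eqP; rewrite -(eqr_nat R) /mmax -sumr_const sum_node_pairs_blocks.
rewrite natr_sum; apply/eqP; apply: eq_bigr => r _.
rewrite natr_sum; apply: eq_bigr => s _.
by rewrite sumr_const card_pairs_between_blocks.
Qed.

End BlockModel.

Theorem mainTheorem3 (R : realType) (T : finType) (q : nat)
    (B : 'I_q -> {set T}) (P : 'M[R]_q)
    (hT : (2 <= #|T|)%N)
    (hB : block_partition B)
    (hPsym : forall r s : 'I_q, P r s = P s r)
    (hP01 : forall r s : 'I_q, 0 <= P r s <= 1) :
  (mmax B)%:R^-1 *
    (\sum_(G in simple_graphs T)
       sbm_prob B P G * ln (sbm_prob B P G / er_prob (avg_density B P) G))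
  = binary_entropy (avg_density B P)
    - \sum_(r < q) \sum_(s < q | (r <= s)%N)
        block_frac R B r s * binary_entropy (P r s).
Proof.
set rho := avg_density B P; set w := sbm_edge_prob B P.
(* Two nodes give at least one pair, so dividing by [mmax B] is legitimate. *)
have m_gt0 : 0 < (mmax B)%:R :> R.
  by rewrite ltr0n -(card_node_pairs R hB) card_pairs_between_self cardsT bin_gt0.
(* No condition on [e] is needed: the default value 0 also lies in the unit interval. *)
have w01 e : 0 <= w e <= 1.
  by rewrite /w /sbm_edge_prob; case: pickP => // _; rewrite lexx ler01.
have sum_w : \sum_(e in node_pairs T) w e = (mmax B)%:R * rho.
  by rewrite /rho /avg_density (sum_block_frac hB id hPsym) mulVKf ?gt_eqF.
have sum_1w : \sum_(e in node_pairs T) (1 - w e) = (mmax B)%:R * (1 - rho).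
  by rewrite sumrB sumr_const (card_node_pairs R hB) sum_w mulrBr mulr1.
(* [mmax B] times [rho] is a sum of nonnegative terms, one of which is positive; the next bound is
   the same argument for [1 - rho]. *)
have rho_gt0 e : e \in node_pairs T -> 0 < w e -> 0 < rho.
  move=> eD we; rewrite -(pmulr_rgt0 _ m_gt0) -sum_w (bigD1 e) //=.
  by rewrite ltr_wpDr // sumr_ge0 // => f _; case/andP: (w01 f).
have rho_lt1 e : e \in node_pairs T -> w e < 1 -> rho < 1.
  move=> eD we; rewrite -subr_gt0 -(pmulr_rgt0 _ m_gt0) -sum_1w (bigD1 e) //=.
  rewrite ltr_wpDr ?subr_gt0 // sumr_ge0 // => f _.
  by rewrite subr_ge0; case/andP: (w01 f).
rewrite (sum_block_frac hB (@binary_entropy R) hPsym).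
rewrite [X in _ * X](indep_edges_kl _ rho_gt0 rho_lt1); last by move=> e _.
rewrite sum_w sum_1w mulrBr /binary_entropy; congr (_ - _).
by rewrite mulrBr mulNr mulrN !mulrA !mulVf ?gt_eqF // !mul1r mulNr.
Qed.
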